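(* Let $p$ be an odd prime. a) Let $B$ be a non-trivial splitting Rota--Baxter operator on $H_3$. Then $B$, up to conjugation by automorphisms of $H_3$ and the action $\widetilde{\ }$, coincides with the operator $B^8_{-1}$ given by $B^8_{-1}(b^sa^tc^r)=b^{-s}$. b) Let $B$ be a non-trivial splitting Rota--Baxter operator on $E_3$. Then $B$, up to conjugation by automorphisms of $E_3$ and the action $\widetilde{\ }$, coincides with the operator $\mathfrak{B}^4_{-1,0}$ given by $\mathfrak{B}^4_{-1,0}(b^sa^tc^r)=b^{t}a^{-t}c^{-\frac{t(t-1)}{2}}$ for $0\le s,t,r\le p-1$.
   Context: Convention: $[g,h]=g^{-1}h^{-1}gh$. $H_3=\langle a,b,c\mid [a,b]=c,\ [a,c]=[b,c]=a^p=b^p=c^p=e\rangle$ and $E_3=\langle a,b,c\mid [a,b]=c,\ a^p=b^p=c,\ [a,c]=[b,c]=c^p=e\rangle$ are groups of order $p^3$; in each, every element is uniquely $b^sa^tc^r$ with $0\le s,t,r\le p-1$. A Rota--Baxter operator on a group $G$ is a map $B\colon G\to G$ such that $B(g)B(h)=B\big(gB(g)hB(g)^{-1}\big)$ for all $g,h\in G$. The trivial ones are $g\mapsto e$ and $g\mapsto g^{-1}$. If $G=HL$ for subgroups $H,L$ with $H\cap L=\{e\}$ (an exact factorization), then $B(hl)=l^{-1}$ ($h\in H$, $l\in L$) defines a Rota--Baxter operator; operators of this form are called splitting. For a Rota--Baxter operator $B$, the operators $\widetilde B(g)=g^{-1}B(g^{-1})$ and $\varphi^{-1}\circ B\circ\varphi$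 ($\varphi\in\mathrm{Aut}(G)$) are Rota--Baxter operators too; ''up to conjugation and the action $\widetilde{\ }$'' refers to the equivalence relation generated by $B\sim\varphi^{-1}\circ B\circ\varphi$ and $B\sim\widetilde B$. *)

(* Defs.v *)
From Stdlib Require Import Relation_Operators.
From mathcomp Require Import all_boot all_fingroup all_solvable.

Set Implicit Arguments.
Unset Strict Implicit.
Unset Printing Implicit Defensive.

Local Open Scope group_scope.

(* MathComp's commutator is [~ g, h] = g^-1 * h^-1 * g * h.                   *)

(* [\isog Grp] does not name the generators of the presented group: the last  *)
(* two clauses say that a, b, c are generators satisfying the relations, and, *)
(* gT being finite, the map from the presented group to gT sending the formal *)
(* generators to a, b, c is then an isomorphism.                              *)
Definition is_H3 (p : nat) (gT : finGroupType) (a b c : gT) : Prop :=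
  [/\ [set: gT] \isog Grp (x : y : z :
        [~ x, y] = z, [~ x, z] = 1, [~ y, z] = 1,
        x ^+ p = 1, y ^+ p = 1, z ^+ p = 1),
      <<[set a; b; c]>> = [set: gT] &
      [/\ [~ a, b] = c, [~ a, c] = 1, [~ b, c] = 1 &
          [/\ a ^+ p = 1, b ^+ p = 1 & c ^+ p = 1]]].

Definition is_E3 (p : nat) (gT : finGroupType) (a b c : gT) : Prop :=
  [/\ [set: gT] \isog Grp (x : y : z :
        [~ x, y] = z, x ^+ p = z, y ^+ p = z,
        [~ x, z] = 1, [~ y, z] = 1, z ^+ p = 1),
      <<[set a; b; c]>> = [set: gT] &
      [/\ [~ a, b] = c, a ^+ p = c, b ^+ p = c &
          [/\ [~ a, c] = 1, [~ b, c] = 1 & c ^+ p = 1]]].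

Section RotaBaxter.
Variable gT : finGroupType.
Implicit Types B C : gT -> gT.

Definition rota_baxter B : Prop :=
  forall g h, B g * B h = B (g * B g * h * (B g)^-1).

Definition trivial_rb B : Prop :=
  (forall g, B g = 1) \/ (forall g, B g = g^-1).

Definition splitting_rb B : Prop :=
  exists H L : {group gT},
    [/\ H * L = [set: gT], H :&: L = 1 &
        {in H & L, forall h l, B (h * l) = l^-1}].

Definition rb_conj (phi : {perm gT}) B : gT -> gT :=
  fun g => phi^-1 (B (phi g)).

Definition rb_tilde B : gT -> gT := fun g => g^-1 * B g^-1.

Definition rb_step B C : Prop :=
  (exists2 phi, phi \in Aut [set: gT] & C =1 rb_conj phi B) \/
  C =1 rb_tilde B.

Definition rb_equiv : (gT -> gT) -> (gT -> gT) -> Prop :=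
  clos_refl_sym_trans (gT -> gT) rb_step.

End RotaBaxter.

Definition is_B8_neg1 (p : nat) (gT : finGroupType) (a b c : gT)
    (B : gT -> gT) : Prop :=
  forall s t r : nat, s < p -> t < p -> r < p ->
    B (b ^+ s * a ^+ t * c ^+ r) = b ^- s.

(* t * t.-1 is even, so the halving below is exact. *)
Definition is_frakB4_neg1_0 (p : nat) (gT : finGroupType) (a b c : gT)
    (B : gT -> gT) : Prop :=
  forall s t r : nat, s < p -> t < p -> r < p ->
    B (b ^+ s * a ^+ t * c ^+ r) = b ^+ t * a ^- t * c ^- (t * t.-1)./2.

(* Main.v *)
From Stdlib Require Import Relation_Operators.
Require Import Defs.
From mathcomp Require Import all_boot all_fingroup all_solvable.

Set Implicit Arguments.
Unset Strict Implicit.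
Unset Printing Implicit Defensive.

Local Open Scope group_scope.

(** In H_3 and E_3 every commutator is a power of the central element c, and
    the p-th power map is an endomorphism because p is odd. A non-trivial exact
    factorization has factors of orders p^2 and p; passing from B to its tilde
    swaps them, so H can be taken of order p^2 and L of order p. Then H is normal
    and abelian, and some x in H and y in L do not commute. By the universal
    property of the presentation it remains to choose generators adapted to
    (H, L): for H_3 map (a, b) to (x, y); for E_3 the group H is cyclic,
    H = <y>, and L contains some v with [y, v] = y^p, so map (a, b) to
    (v^-1 y, y). *)

(** * Homomorphisms and automorphisms obtained from the presentations *)

Definition H3_rel (p : nat) (gT : finGroupType) (a b c : gT) : Prop :=
  [/\ [~ a, b] = c, [~ a, c] = 1, [~ b, c] = 1 &
      [/\ a ^+ p = 1, b ^+ p = 1 & c ^+ p = 1]].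

Definition E3_rel (p : nat) (gT : finGroupType) (a b c : gT) : Prop :=
  [/\ [~ a, b] = c, a ^+ p = c, b ^+ p = c &
      [/\ [~ a, c] = 1, [~ b, c] = 1 & c ^+ p = 1]].

Lemma gen_set3 (gT : finGroupType) (x y z : gT) :
  <<[set x; y; z]>> = <[x]> <*> <[y]> <*> <[z]>.
Proof.
have ->: <[x]> <*> <[y]> = <<[set x; y]>> by rewrite joing_idl joing_idr.
by rewrite joing_idl joing_idr.
Qed.

(** Universal property of the presentation: [isoG] identifies the homomorphic images of the group
    with the groups generated by a triple satisfying the relations. *)
Lemma homg_of_H3 p (gT : finGroupType) (a b c : gT) :
  is_H3 p a b c -> forall (rT : finGroupType) (x y z : rT),
  H3_rel p x y z -> <<[set x; y; z]>> \homg [set: gT].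
Proof.
case=> isoG _ _ rT x y z [xy xz yz [xp yp zp]].
rewrite isoG; apply/existsP; exists (x, y, z) => /=.
by rewrite gen_set3 !xpair_eqE /= xy xz yz xp yp zp !eqxx.
Qed.

Lemma homg_of_E3 p (gT : finGroupType) (a b c : gT) :
  is_E3 p a b c -> forall (rT : finGroupType) (x y z : rT),
  E3_rel p x y z -> <<[set x; y; z]>> \homg [set: gT].
Proof.
case=> isoG _ _ rT x y z [xy xp yp [xz yz zp]].
rewrite isoG; apply/existsP; exists (x, y, z) => /=.
by rewrite gen_set3 !xpair_eqE /= xy xz yz xp yp zp !eqxx.
Qed.

(* The subgroup D generated by the graph is no larger than the group, so both
   projections D -> gT, which are onto, are isomorphisms. *)
Lemma aut_of_graph (gT : finGroupType) (a b c x y z : gT) :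
  <<[set a; b; c]>> = [set: gT] -> <<[set x; y; z]>> = [set: gT] ->
  <<[set (a, x); (b, y); (c, z)]>> \homg [set: gT] ->
  exists2 phi : {perm gT}, phi \in Aut [set: gT] &
    [/\ phi a = x, phi b = y & phi c = z].
Proof.
set S := [set (a, x); _; _] => genabc genxyz homD.
pose f := restrm (subsetT <<S>>) fst; pose g := restrm (subsetT <<S>>) snd.
have imf : f @* <<S>> = [set: gT].
  rewrite morphim_restrm setIid morphim_gen ?subsetT //.
  by rewrite !morphimU !morphim_set1 ?inE.
have img : g @* <<S>> = [set: gT].
  rewrite morphim_restrm setIid morphim_gen ?subsetT //.
  by rewrite !morphimU !morphim_set1 ?inE.
have leD := leq_homg homD.
have injf : 'injm f.
  by apply/injmP/imset_injP; rewrite -morphimEdom imf eqn_leq leD -imf leq_morphim.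
have injg : 'injm g.
  by apply/injmP/imset_injP; rewrite -morphimEdom img eqn_leq leD -img leq_morphim.
have inf u : u \in f @* <<S>> by rewrite imf inE.
pose fi := invm injf; pose h u := g (fi u).
have fiD u : fi u \in <<S>>
  by have := mem_morphim (invm_morphism injf) (inf u) (inf u); rewrite im_invm.
have hM : {morph h : u v / u * v}.
  by move=> u v; rewrite /h /fi (morphM (invm_morphism injf)) // morphM ?fiD.
have hinj : injective h.
  move=> u v /(injmP injg) eqfi.
  by apply: (injmP (injm_invm injf)) => //; apply: eqfi.
have hE u v : (u, v) \in S -> h u = v.
  move=> Suv; have Duv := mem_gen Suv.
  by rewrite /h -[u]/(f (u, v)) /fi invmE.
exists (perm hinj); last by rewrite !permE; split; apply: hE; rewrite !inE eqxx ?orbT.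
rewrite inE; apply/andP; split; first by apply/subsetP=> u _; rewrite inE.
by apply/morphicP=> u v _ _; rewrite !permE hM.
Qed.

Lemma expg_pair (gT rT : finGroupType) (u u' : gT) (v v' : rT) n :
  u ^+ n = u' -> v ^+ n = v' -> (u, v) ^+ n = (u', v').
Proof. by move=> <- <-; elim: n => // n IHn; rewrite !expgS IHn. Qed.

(** Relations in a direct product are checked componentwise. This makes the group generated by the
    graph a homomorphic image of the presented group, as [aut_of_graph] requires. *)
Lemma H3_rel_pair p (gT rT : finGroupType) (a b c : gT) (x y z : rT) :
  H3_rel p a b c -> H3_rel p x y z -> H3_rel p (a, x) (b, y) (c, z).
Proof.
case=> ab ac bc [ap bp cp] [xy xz yz [xp yp zp]].
have commE (g g' : gT) (h h' : rT) : [~ (g, h), (g', h')] = ([~ g, g'], [~ h, h']).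
  by [].
split; rewrite ?commE ?(ab, xy) ?(ac, xz) ?(bc, yz) //.
by split; apply: expg_pair.
Qed.

Lemma E3_rel_pair p (gT rT : finGroupType) (a b c : gT) (x y z : rT) :
  E3_rel p a b c -> E3_rel p x y z -> E3_rel p (a, x) (b, y) (c, z).
Proof.
case=> ab ap bp [ac bc cp] [xy xp yp [xz yz zp]].
have commE (g g' : gT) (h h' : rT) : [~ (g, h), (g', h')] = ([~ g, g'], [~ h, h']).
  by [].
split; try exact: expg_pair; first by rewrite commE ab xy.
by split; rewrite ?commE ?(ac, xz) ?(bc, yz) //; apply: expg_pair.
Qed.

(** * Commutators and p-th powers in class two *)

Section Class2.

Variables (p : nat) (gT : finGroupType) (a b c : gT).
Hypotheses (p_pr : prime p) (p_odd : odd p).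
Hypothesis gen_abc : <<[set a; b; c]>> = [set: gT].
Hypotheses (ab : [~ a, b] = c) (ac : [~ a, c] = 1) (bc : [~ b, c] = 1).
Hypothesis cp : c ^+ p = 1.

Lemma commute_c (g : gT) : commute g c.
Proof.
have: [set: gT] \subset 'C[c].
  rewrite -gen_abc gen_subG !subUset !sub1set.
  by rewrite !(sameP cent1P commgP) ac bc commgg eqxx.
by move/subsetP/(_ g (in_setT g))/cent1P.
Qed.

(** [<[c]>] is central, hence normal, and modulo it the generators commute, so it contains the
    derived subgroup. *)
Lemma mem_cycle_comm (g h : gT) : [~ g, h] \in <[c]>.
Proof.
have nZ : [set: gT] \subset 'N(<[c]>).
  rewrite cents_norm // cent_cycle; apply/subsetP => u _.
  exact/cent1P/commute_c.
have abZ : abelian ([set: gT] / <[c]>).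
  rewrite -gen_abc quotient_gen; last exact: subset_trans (subsetT _) nZ.
  rewrite abelian_gen; apply/centsP => _ /morphimP[u Nu Su ->].
  move=> _ /morphimP[v Nv Sv ->]; apply/commgP.
  rewrite -morphR //= coset_id //; move: Su Sv; rewrite !inE.
  have ba : [~ b, a] = c^-1 by rewrite -ab invg_comm.
  have ca : [~ c, a] = 1 by rewrite -invg_comm ac invg1.
  have cb : [~ c, b] = 1 by rewrite -invg_comm bc invg1.
  by move=> /orP[/orP[]|] /eqP-> /orP[/orP[]|] /eqP->;
    rewrite ?commgg ?ab ?ba ?ac ?ca ?bc ?cb ?groupV ?group1 ?cycle_id.
have := der1_min nZ abZ; rewrite derg1 => /subsetP; apply.
by rewrite mem_commg ?inE.
Qed.

Lemma commute_comm (k g h : gT) : commute k [~ g, h].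
Proof. by have /cycleP[i ->] := mem_cycle_comm g h; apply/commuteX/commute_c. Qed.

(** In class two the error term is [[~ h, g]] to the power ['C(p, 2)]; for odd [p] this exponent is
    a multiple of [p], which kills every power of [c]. *)
Lemma expMg_odd (g h : gT) : (g * h) ^+ p = g ^+ p * h ^+ p.
Proof.
rewrite expMg_Rmul; try exact: commute_comm.
have /cycleP[i ->] := mem_cycle_comm h g.
by rewrite bin2odd // -expgM mulnA expgM mulnC expgM cp !expg1n mulg1.
Qed.

(** By [expMg_odd] the elements whose p-th power lies in [K] form a subgroup, so generators suffice.
    It is applied with [K] trivial for H_3 and [K] equal to [<[c]>] for E_3. *)
Lemma expg_p_mem (K : {group gT}) :
  a ^+ p \in K -> b ^+ p \in K -> forall g, g ^+ p \in K.
Proof.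
move=> Kap Kbp g.
have gK : group_set [set u | u ^+ p \in K].
  apply/group_setP; split=> [|u v]; rewrite !inE ?expg1n ?group1 // => Ku Kv.
  by rewrite expMg_odd groupM.
have: [set: gT] \subset Group gK.
  by rewrite -gen_abc gen_subG !subUset !sub1set !inE Kap Kbp cp group1.
by move/subsetP/(_ g (in_setT g)); rewrite inE.
Qed.

(** A proper subgroup has order at most [p ^ 2], hence is abelian and cannot contain both [u] and
    [v]. *)
Lemma noncommuting_gen (u v w : gT) :
  #|[set: gT]| = (p ^ 3)%N -> [~ u, v] != 1 -> <<[set u; v; w]>> = [set: gT].
Proof.
move=> oG; apply: contraNeq.
pose K := <<[set u; v; w]>>%G; rewrite -[<<_>>]/(gval K) => neqG.
have pG : p.-group [set: gT] by rewrite /pgroup oG pnatX pnat_id.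
have abK : abelian K.
  apply: (p2group_abelian (pgroupS (subsetT _) pG)).
  have ltK : K \proper [set: gT] by rewrite properT.
  have [|i le_i3 oK] := dvdn_pfactor #|K| 3 p_pr _.
    by rewrite -oG cardSg ?subsetT.
  have := proper_card ltK; rewrite oK oG ltn_exp2l ?prime_gt1 //.
  by rewrite pfactorK.
apply/commgP/(centsP abK); apply: mem_gen; rewrite !inE eqxx ?orbT //.
Qed.

(* If c = 1 the group is the product of two subgroups of order at most p. *)
Lemma c_neq1 : #|[set: gT]| = (p ^ 3)%N -> a ^+ p \in <[c]> -> b ^+ p \in <[c]> ->
  c != 1.
Proof.
move=> oG ap bp; apply/eqP=> c1.
move: ap bp; rewrite c1 cycle1 !inE => ap bp.
have cab : <[b]> \subset 'C(<[a]>).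
  by apply/cents_cycle/esym/commgP; rewrite ab c1.
have defG : <[a]> * <[b]> = [set: gT].
  by rewrite -(cent_joinEr cab) -gen_abc gen_set3 c1 cycle1 joingG1.
have := mul_cardG <[a]> <[b]>; rewrite defG oG => oab.
have : #[a] * #[b] <= p * p.
  by rewrite leq_mul // dvdn_leq ?prime_gt0 // order_dvdn ?ap ?bp.
rewrite /order oab => /(leq_trans (leq_pmulr _ (cardG_gt0 _))).
by rewrite mulnn leq_exp2l ?prime_gt1.
Qed.

End Class2.

(** * Orders of the two groups *)

Lemma gen_set3_comm (gT : finGroupType) (x y : gT) :
  <<[set x; y; [~ x, y]]>> = <[x]> <*> <[y]>.
Proof.
rewrite gen_set3; apply/joing_idPl; rewrite cycle_subG.
by rewrite groupR // -cycle_subG (joing_subl, joing_subr).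
Qed.

(** The hypotheses are the relations of the modular group of order [p ^ 3], and the triple is a
    change of generators turning them into those of E_3. It serves both to find the order of E_3 and
    to adapt generators to a factorization. *)
Lemma E3_rel_of_modular p (gT : finGroupType) (v y : gT) :
    odd p -> v ^+ p = 1 -> y ^+ (p ^ 2) = 1 -> y ^ v = y ^+ p.+1 ->
  E3_rel p (v^-1 * y) y (y ^+ p).
Proof.
move=> p_odd vp ypp yv.
have yvE : [~ y, v] = y ^+ p by rewrite commgEl yv expgS mulKg.
have cyz : commute y (y ^+ p) by apply: commuteX.
have cvz : commute v (y ^+ p).
  apply/esym/commgP; rewrite commgEl conjXg yv -!expgVn -expgM mulSn expgD.
  by rewrite mulnn ypp mulg1 expgVn mulVg.
have cvz' : commute v^-1 (y ^+ p) by apply/esym/commuteV.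
have vyE : [~ v^-1, y] = y ^+ p.
  rewrite commVg -invg_comm yvE ?invgK //; exact: commuteV.
have cxz : commute (v^-1 * y) (y ^+ p) by apply/esym/commuteM/esym.
split; first 1 last.
- rewrite expMg_Rmul -?(invg_comm v^-1) vyE; try exact: commuteV.
  have zp : y ^- p ^+ p = 1 by rewrite expgVn -expgM mulnn ypp invg1.
  by rewrite bin2odd // [_ ^- p ^+ _]expgM zp expg1n mulg1 expgVn vp invg1 mul1g.
- by [].
- by split; [apply/eqP/commgP | apply/eqP/commgP | rewrite -expgM mulnn].
by rewrite commMgJ vyE commgg mulg1 /conjg -cyz mulKg.
Qed.

(** The presentations give surjections both ways between this group and the extraspecial group of
    [card_pX1p2], so the orders agree. *)
Lemma card_H3 p (gT : finGroupType) (a b c : gT) :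
  prime p -> is_H3 p a b c -> #|[set: gT]| = (p ^ 3)%N.
Proof.
move=> p_pr GH3; have [_ gen_abc [ab ac bc [ap bp cp]]] := GH3.
apply/eqP; rewrite -(card_pX1p2 p_pr) eqn_leq; apply/andP; split.
  apply: leq_homg; rewrite (Grp_pX1p2 p_pr); apply/existsP; exists (a, b) => /=.
  rewrite -gen_abc -{1}ab gen_set3_comm !xpair_eqE /= ap bp.
  by rewrite ab -(invg_comm a c) -(invg_comm b c) ac bc !invg1 !eqxx.
have /existsP[[x y]] := isoGrp_hom (Grp_pX1p2 p_pr).
rewrite /= !xpair_eqE => /and5P[/eqP genxy /eqP xp /eqP yp /eqP zx /eqP zy].
rewrite -genxy -gen_set3_comm; apply: leq_homg; apply: (homg_of_H3 GH3).
have cxz : commute x [~ x, y] by apply/esym/commgP/eqP.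
split; [by [] | by apply/eqP/commgP | by apply/eqP/commgP/esym/commgP/eqP |].
by split; rewrite // -commXg // xp comm1g.
Qed.

(** Same two-way comparison, now with the modular group ['Mod_(p ^ 3)]. *)
Lemma card_E3 p (gT : finGroupType) (a b c : gT) :
  prime p -> odd p -> is_E3 p a b c -> #|[set: gT]| = (p ^ 3)%N.
Proof.
move=> p_pr p_odd GE3; have [_ gen_abc [ab ap bp [ac bc cp]]] := GE3.
have Gmod := @Grp_modular_group p 3 p_pr isT.
apply/eqP; rewrite -(@card_modular_group p 3 p_pr isT) eqn_leq.
apply/andP; split.
  (* The witness inverts the substitution of [E3_rel_of_modular]: from [a = v^-1 * y] and [b = y]
     one gets [v = b * a^-1]. *)
  apply: leq_homg; rewrite Gmod; apply/existsP; exists (b, b * a^-1) => /=.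
  have genG : <[b]> <*> <[b * a^-1]> = [set: gT].
    apply/eqP; rewrite eqEsubset subsetT -gen_abc -ab gen_set3_comm.
    set K := <[b]> <*> _; have Kb : b \in K by rewrite -cycle_subG joing_subl.
    rewrite join_subG !cycle_subG Kb andbT -groupV -(groupMl _ Kb).
    by rewrite -cycle_subG joing_subr.
  rewrite genG !xpair_eqE eqxx /=.
  have cc := commute_c gen_abc ac bc.
  rewrite expgM !bp cp eqxx (expMg_odd p_odd gen_abc ab ac bc cp).
  rewrite expgVn ap bp mulgV eqxx /= conjgM [b ^ b]conjgE mulKg conjgE invgK.
  by rewrite expn1 expgS bp mulgA (commgC a b) ab -!mulgA -(cc a^-1) mulKVg.
have /existsP[[y v]] := isoGrp_hom Gmod.
rewrite /= !xpair_eqE => /and4P[/eqP genyv /eqP ypp /eqP vp /eqP yv].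
have E3 := E3_rel_of_modular p_odd vp ypp yv.
have <- : <<[set v^-1 * y; y; y ^+ p]>> = 'Mod_(p ^ 3).
  have [<- _ _ _] := E3; rewrite gen_set3_comm -genyv.
  apply/eqP; rewrite eqEsubset; set K := <[v^-1 * y]> <*> _; set K' := <[y]> <*> _.
  have [Ky K'y] : y \in K /\ y \in K' by rewrite -!cycle_subG joing_subl joing_subr.
  rewrite !join_subG !cycle_subG Ky K'y !andbT.
  rewrite groupMr // groupV -cycle_subG joing_subr -groupV -(groupMr _ Ky).
  by rewrite -cycle_subG joing_subl.
exact/leq_homg/(homg_of_E3 GE3).
Qed.

(** * Splitting operators and exact factorizations *)

Lemma splitting_rb_tilde (gT : finGroupType) (B : gT -> gT) (H L : {group gT}) :
  {in H & L, forall h l, B (h * l) = l^-1} ->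
  {in L & H, forall l h, rb_tilde B (l * h) = h^-1}.
Proof.
move=> BHL l h Ll Hh.
by rewrite /rb_tilde invMg BHL ?groupV // invgK mulgKV.
Qed.

Lemma nontrivial_splitting (p : nat) (gT : finGroupType) (B : gT -> gT) :
    prime p -> #|[set: gT]| = (p ^ 3)%N -> splitting_rb B -> ~ trivial_rb B ->
  exists B' (H L : {group gT}),
    [/\ rb_equiv B B', H * L = [set: gT], #|H| = (p ^ 2)%N, #|L| = p &
        {in H & L, forall h l, B' (h * l) = l^-1}].
Proof.
move=> p_pr oG [H [L [defG tiHL BHL]]] Bnt; have p_gt1 := prime_gt1 p_pr.
have oHL : (#|H| * #|L|)%N = (p ^ 3)%N by rewrite -oG -defG TI_cardMg.
have [i _ oH] : exists2 i, i <= 3 & #|H| = (p ^ i)%N.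
  by apply/(dvdn_pfactor _ _ p_pr); rewrite -oHL dvdn_mulr.
have [j _ oL] : exists2 j, j <= 3 & #|L| = (p ^ j)%N.
  by apply/(dvdn_pfactor _ _ p_pr); rewrite -oHL dvdn_mull.
have ij : (i + j)%N = 3.
  by apply/eqP; rewrite -(eqn_exp2l _ _ p_gt1) expnD -oH -oL oHL.
(* For [i = 0] the operator is inversion, for [i = 1] the tilde exchanges the factors, for [i = 2]
   nothing changes, and for [i = 3] the operator is constantly [1]. *)
case: i oH ij => [|[|[|[|i]]]] oH ij //; case: j oL ij => [|[|[|[|j]]]] oL //= _.
- case: Bnt; right=> g.
  have L_T : L :=: [set: gT] by rewrite -defG (card1_trivg oH) mul1g.
  by rewrite -{1}[g]mul1g BHL ?group1 // L_T inE.
- exists (rb_tilde B), L, H; split=> //; last exact: splitting_rb_tilde.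
    by apply: rst_step; right.
  have /comm_group_setP cHL : group_set (H * L) by rewrite defG groupP.
  by rewrite -defG -cHL.
- by exists B, H, L; split=> //; apply: rst_refl.
- case: Bnt; left=> g.
  have H_T : H :=: [set: gT] by rewrite -defG (card1_trivg oL) mulg1.
  by rewrite -[g]mulg1 BHL ?group1 ?invg1 // H_T inE.
Qed.

Section Factorization.

Variables (p : nat) (gT : finGroupType) (H L : {group gT}).
Hypotheses (p_pr : prime p) (oG : #|[set: gT]| = (p ^ 3)%N).
Hypotheses (defG : H * L = [set: gT]) (oH : #|H| = (p ^ 2)%N) (oL : #|L| = p).

(** In a p-group a subgroup of index [p] is maximal, and maximal subgroups are normal. *)
Lemma factor_normal : H <| [set: gT].
Proof.
have pG : p.-group [set: gT] by rewrite /pgroup oG pnatX pnat_id.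
apply: (p_maximal_normal pG); apply: p_index_maximal; first exact: subsetT.
by rewrite -divgS ?subsetT // oG oH -expnB ?prime_gt0.
Qed.

Lemma factor_abelian : abelian H /\ abelian L.
Proof.
split; last by rewrite cyclic_abelian // prime_cyclic ?oL.
apply: (@p2group_abelian _ p); last by rewrite oH pfactorK.
by rewrite /pgroup oH pnatX pnat_id.
Qed.

(** Otherwise the group would be a product of two commuting abelian subgroups, hence abelian. *)
Lemma factor_noncommuting (a b : gT) :
  [~ a, b] != 1 -> exists x y, [/\ x \in H, y \in L & [~ x, y] != 1].
Proof.
move=> ab; have [abH abL] := factor_abelian.
have : ~~ (L \subset 'C(H)).
  apply: contra ab => cHL; apply/commgP; apply: (centsP (A := [set: gT])); rewrite ?inE //.
  by rewrite -/(abelian _) -defG abelianM abH abL.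
case/subsetPn=> y Ly; rewrite -sub_cent1 => /subsetPn[x Hx].
by rewrite (sameP cent1P commgP) => xy; exists x, y.
Qed.

(** Lets the operator be evaluated modulo [H], with no explicit factorization of [g]. *)
Lemma splitting_coset (B : gT -> gT) (g l : gT) :
    {in H & L, forall h l, B (h * l) = l^-1} -> l \in L ->
  coset H g = coset H l -> B g = l^-1.
Proof.
move=> BHL Ll eq_gl; have nH u : u \in 'N(H).
  by have /andP[_ /subsetP] := factor_normal; apply; rewrite inE.
have /rcosetP[h Hh ->] : g \in H :* l by apply/rcoset_kercosetP.
exact: BHL.
Qed.

End Factorization.

Section AutAction.

Variables (gT : finGroupType) (phi : {perm gT}).
Hypothesis Aphi : phi \in Aut [set: gT].

Lemma autM (u v : gT) : phi (u * v) = phi u * phi v.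
Proof. by apply: (morphM (autm_morphism Aphi)); rewrite inE. Qed.

Lemma autX (u : gT) n : phi (u ^+ n) = phi u ^+ n.
Proof. by apply: (morphX (autm_morphism Aphi)); rewrite inE. Qed.

Lemma autV (u : gT) : phi u^-1 = (phi u)^-1.
Proof. by apply: (morphV (autm_morphism Aphi)); rewrite inE. Qed.

End AutAction.

(** * Classification in H_3 and in E_3 *)

Lemma splitting_H3 p (gT : finGroupType) (a b c : gT) (B : gT -> gT) :
    prime p -> odd p -> is_H3 p a b c -> splitting_rb B -> ~ trivial_rb B ->
  exists2 B8 : gT -> gT, is_B8_neg1 p a b c B8 & rb_equiv B B8.
Proof.
move=> p_pr p_odd GH3 splB ntB; have oG := card_H3 p_pr GH3.
have [_ gen_abc relG] := GH3; have [ab ac bc [ap bp cp]] := relG.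
have [B' [H [L [BB' defG oH oL BHL]]]] := nontrivial_splitting p_pr oG splB ntB.
have nHG := factor_normal p_pr oG oH.
have nH u : u \in 'N(H) by apply: (subsetP (normal_norm nHG)); rewrite inE.
have expp (g : gT) : g ^+ p = 1.
  by apply/set1gP/(@expg_p_mem _ _ _ _ _ p_odd gen_abc ab ac bc cp [1]%G);
    rewrite ?ap ?bp group1.
have c_nt : c != 1 by apply: (c_neq1 p_pr gen_abc ab oG); rewrite ?ap ?bp group1.
have [|x [y [Hx Ly xy]]] := factor_noncommuting (a := a) (b := b) p_pr defG oH oL.
  by rewrite ab.
have cxy k := commute_comm gen_abc ab ac bc k x y.
(* All p-th powers are trivial and commutators are central, so [x], [y], [[~ x, y]] satisfy the
   relations of H_3. *)
have [|phi Aphi [phia phib phic]] := aut_of_graph gen_abc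
    (noncommuting_gen p_pr [~ x, y] oG xy).
  apply/(homg_of_H3 GH3)/H3_rel_pair => //; split; rewrite ?expp //;
    by apply/eqP/commgP.
exists (rb_conj phi B'); last first.
  by apply: (rst_trans _ _ _ _ _ BB'); apply: rst_step; left; exists phi.
move=> s t r _ _ _.
rewrite /rb_conj !(autM Aphi) !(autX Aphi) phia phib phic.
have Hz : [~ x, y] \in H by rewrite commgEl groupM ?groupV // memJ_norm.
(* Since [x] and [[~ x, y]] lie in [H], the image of [b ^+ s * a ^+ t * c ^+ r] is [y ^+ s] modulo
   [H]. *)
rewrite (splitting_coset p_pr oG oH BHL (groupX s Ly)).
  by rewrite -phib -(autX Aphi) -(autV Aphi) permK.
by rewrite !morphM ?morphX ?nH //= (coset_id Hx) (coset_id Hz) !expg1n !mulg1.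
Qed.

Lemma splitting_E3 p (gT : finGroupType) (a b c : gT) (B : gT -> gT) :
    prime p -> odd p -> is_E3 p a b c -> splitting_rb B -> ~ trivial_rb B ->
  exists2 B4 : gT -> gT, is_frakB4_neg1_0 p a b c B4 & rb_equiv B B4.
Proof.
move=> p_pr p_odd GE3 splB ntB; have oG := card_E3 p_pr p_odd GE3.
have [_ gen_abc relG] := GE3; have [ab ap bp [ac bc cp]] := relG.
have [B' [H [L [BB' defG oH oL BHL]]]] := nontrivial_splitting p_pr oG splB ntB.
have nHG := factor_normal p_pr oG oH.
have nH u : u \in 'N(H) by apply: (subsetP (normal_norm nHG)); rewrite inE.
have expp g : g ^+ p \in <[c]>.
  by apply: (@expg_p_mem _ _ _ _ _ p_odd gen_abc ab ac bc cp _%G);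
    rewrite ?ap ?bp cycle_id.
have c_nt : c != 1 by apply: (c_neq1 p_pr gen_abc ab oG); rewrite ?ap ?bp cycle_id.
have oc : #[c] = p by apply: nt_prime_order.
have Lp u : u \in L -> u ^+ p = 1 by move=> Lu; rewrite -oL expg_cardG.
(* If all p-th powers in [H] were trivial, writing [a = h * l] would give
   [c = a ^+ p = h ^+ p * l ^+ p = 1]. *)
have [y Hy yp] : exists2 y, y \in H & y ^+ p != 1.
  apply/exists_inP; apply: contraR c_nt => /exists_inPn Hp.
  have : a \in H * L by rewrite defG inE.
  case/mulsgP=> h l Hh Ll def_a; rewrite -ap def_a.
  by rewrite (expMg_odd p_odd gen_abc ab ac bc cp) (Lp l Ll) mulg1 -[_ == _]negbK Hp.
have defH : <[y]> = H.
  apply/eqP; rewrite eqEcard cycle_subG Hy oH.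
  have [|i le_i2 oy] := dvdn_pfactor #[y] 2 p_pr _.
    by rewrite -oH order_dvdG.
  rewrite -orderE oy leq_exp2l ?(prime_gt1 p_pr) // leqNgt; apply: contra yp.
  by rewrite ltnS -order_dvdn oy => le_i1; rewrite -{2}(expn1 p) dvdn_exp2l.
have [|x [v0 [Hx Lv0 xv0]]] := factor_noncommuting (a := a) (b := b) p_pr defG oH oL.
  by rewrite ab.
have {x Hx xv0} yv0 : [~ y, v0] != 1.
  apply: contra xv0 => /commgP cyv0; apply/commgP.
  by move: Hx; rewrite -defH => /cycleP[k ->]; apply/esym/commuteX/esym.
have ccomm := commute_comm gen_abc ab ac bc.
(* [[~ y, v0]] is a nontrivial element of [<[c]>], of prime order, so it generates it and [y ^+ p]
   is a power of it; the exponent moves onto [v0] by bilinearity of commutators. *)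
have [m yv] : exists m, y ^+ p = [~ y, v0 ^+ m].
  have /cycleP[m yvm] : y ^+ p \in <[ [~ y, v0] ]>.
    suff -> : <[ [~ y, v0] ]> = <[c]> by [].
    have cyv := mem_cycle_comm gen_abc ab ac bc y v0.
    apply/eqP; rewrite eqEcard cycle_subG cyv -!orderE oc.
    rewrite (@nt_prime_order _ p) ?leqnn //.
    by case/cycleP: cyv => k ->; rewrite -expgM mulnC expgM cp expg1n.
  by exists m; rewrite commgX.
set v := v0 ^+ m in yv; have Lv : v \in L by apply: groupX.
have rel_xy : E3_rel p (v^-1 * y) y (y ^+ p).
  apply: E3_rel_of_modular; rewrite ?Lp //; first by rewrite -oH expg_cardG.
  by rewrite expgS yv commgEl mulKVg.
have xy : [~ v^-1 * y, y] != 1 by have [->] := rel_xy.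
have [|phi Aphi [phia phib phic]] := aut_of_graph gen_abc
    (noncommuting_gen p_pr (y ^+ p) oG xy).
  exact/(homg_of_E3 GE3)/E3_rel_pair.
exists (rb_conj phi B'); last first.
  by apply: (rst_trans _ _ _ _ _ BB'); apply: rst_step; left; exists phi.
move=> s t r _ _ _.
rewrite /rb_conj !(autM Aphi) !(autX Aphi) phia phib phic.
have Lvt : v^-1 ^+ t \in L by rewrite groupX ?groupV.
(* Modulo [H], the images of [b] and [c] vanish and that of [a] is [v^-1]. *)
rewrite (splitting_coset p_pr oG oH BHL Lvt); last first.
  rewrite !(morphM, morphX) ?nH ?groupX ?groupM ?nH //= (coset_id Hy).
  by rewrite !expg1n mulg1 mul1g mulg1.
(* The power of [c] is the class-two correction [[~ a^-1, b] ^+ 'C(t, 2)], with [[~ a^-1, b] =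
   c^-1]. *)
have -> : b ^+ t * a ^- t * c ^- (t * t.-1)./2 = (b * a^-1) ^+ t.
  rewrite expMg_Rmul; try exact: ccomm.
  by rewrite bin2 commVg ?ab ?expgVn //; apply: commute_c gen_abc ac bc _.
(* It remains that [phi] sends [b * a^-1] to [y * (v^-1 * y)^-1 = v]. *)
apply: (canLR (permK phi)).
rewrite (autX Aphi) (autM Aphi) (autV Aphi) phia phib.
by rewrite invMg invgK mulKVg expgVn invgK.
Qed.

Theorem proposition16 (p : nat) (p_prime : prime p) (p_odd : odd p) :
  (forall (gT : finGroupType) (a b c : gT), is_H3 p a b c ->
     forall B : gT -> gT,
       rota_baxter B -> splitting_rb B -> ~ trivial_rb B ->
       exists2 B8 : gT -> gT, is_B8_neg1 p a b c B8 & rb_equiv B B8) /\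
  (forall (gT : finGroupType) (a b c : gT), is_E3 p a b c ->
     forall B : gT -> gT,
       rota_baxter B -> splitting_rb B -> ~ trivial_rb B ->
       exists2 B4 : gT -> gT, is_frakB4_neg1_0 p a b c B4 & rb_equiv B B4).
Proof.
split=> gT a b c Gabc B _.
  exact: splitting_H3.
exact: splitting_E3.
Qed.
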